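(* Let $R\in\mathcal{S}_1\cap B(H)_+$ be a positive trace class operator, with packet content operators $\{C_w(R)\}_{w\in\mathcal{T}}$. Then: (1) There exists a unique finite Borel measure $\mu_R$ on $\partial\mathcal{T}$ such that $\mu_R([w])=\mathrm{tr}(C_w(R))$ for every $w\in\mathcal{T}$. In particular $\mu_R(\partial\mathcal{T})=\mathrm{tr}(R)$. (2) For each $x\in H$ there exists a function $e_x\in L^1(\partial\mathcal{T},\mu_R)$ with $e_x\ge 0$ $\mu_R$-almost everywhere such that $$\langle x,C_w(R)x\rangle=\int_{[w]}e_x(\omega)\,d\mu_R(\omega)\quad\text{for every node } w\in\mathcal{T}.$$ Also, $\langle x,Rx\rangle=\int_{\partial\mathcal{T}}e_x(\omega)\,d\mu_R(\omega)$. (3) The assignment $x\mapsto e_x$ is quadratic in the following sense: for all $x,y\in H$, $$e_{x+y}+e_{x-y}=2(e_x+e_y)\quad\text{in } L^1(\partial\mathcal{T},\mu_R).$$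
   Context: $H$ is a Hilbert space and $B(H)_+$ is the set of bounded positive operators on $H$; $\mathcal{S}_1$ is the trace class. $\mathcal{T}$ is a rooted finitely branching tree with root $\emptyset$; $|w|$ denotes the depth of a node $w$ and $\mathrm{ch}(w)$ the finite set of children of $w$. $\{W_w\}_{w\in\mathcal{T}}$ is a family of closed subspaces of $H$ with orthogonal projections $P_w$ such that: for each $n\ge 0$, $H=\bigoplus_{|w|=n}W_w$ (orthogonal sum), so $I=\sum_{|w|=n}P_w$; and for each node $w$, $W_w=\bigoplus_{v\in\mathrm{ch}(w)}W_v$ (orthogonal sum), i.e. $P_w=\sum_{v\in\mathrm{ch}(w)}P_v$ with $P_vP_{v'}=0$ for distinct $v,v'\in\mathrm{ch}(w)$. The packet content operator of $R\in B(H)_+$ at $w$ is $C_w(R)=R^{1/2}P_wR^{1/2}\in B(H)_+$. $\partial\mathcal{T}$ is the set of infinite paths in $\mathcal{T}$ starting at the root; for a node $w$, the cylinder set is $[w]=\{\omega\in\partial\mathcal{T}:\omega\text{ begins with }w\}$ (so $[\emptyset]=\partial\mathcal{T}$). The topology on $\partial\mathcal{T}$ is generated by the cylinder sets, and the Borel $\sigma$-algebra is the $\sigma$-algebra generated by them. *)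

(* Defs.v *)
From HB Require Import structures.
From mathcomp Require Import all_boot all_order all_algebra.
From mathcomp Require Import all_classical all_reals all_analysis.
From mathcomp Require Import complex.

Set Implicit Arguments.
Unset Strict Implicit.
Unset Printing Implicit Defensive.

Import Order.TTheory GRing.Theory Num.Theory.
Import numFieldNormedType.Exports.

Local Open Scope classical_set_scope.
Local Open Scope complex_scope.
Local Open Scope ring_scope.

(* Complex Hilbert spaces; the inner product is linear in its second argument. *)
HB.mixin Record CompleteNormedModule_isHilbert (R : realType) H
    of CompleteNormedModule R[i] H := {
  inner : H -> H -> R[i] ;
  inner_linear : forall (x y z : H) (a : R[i]),
    inner x (a *: y + z) = a * inner x y + inner x z ;
  inner_conj : forall x y : H, inner y x = (inner x y)^* ;
  inner_norm : forall x : H, inner x x = `|x| ^+ 2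
}.

#[short(type="hilbertType")]
HB.structure Definition Hilbert (R : realType) :=
  {H of CompleteNormedModule R[i] H & CompleteNormedModule_isHilbert R H}.

Section Operators.
Context {R : realType} {H : hilbertType R}.
Implicit Types (T S : H -> H) (W V : set H).

Definition bounded_operator T : Prop :=
  linear T /\ exists M : R, forall x, `|T x| <= M%:C * `|x|.

(* The order of [R[i]] makes [0 <= z] mean that z is real and nonnegative. *)
Definition positive_operator T : Prop :=
  bounded_operator T /\ forall x, 0 <= inner x (T x).

(* [adjoint], [sqrt_operator], [proj] and [hilbert_basis] below select, by
   choice, an object with the defining property, with a default value when
   there is none. *)
Definition adjoint T : H -> H :=
  xget (fun=> 0) [set S | bounded_operator S /\
    forall x y, inner (T x) y = inner x (S y)].

Definition sqrt_operator T : H -> H :=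
  xget (fun=> 0) [set S | positive_operator S /\ S \o S = T].

Definition abs_operator T : H -> H := sqrt_operator (adjoint T \o T).

Definition orthonormal_basis (B : set H) : Prop :=
  [/\ forall e, B e -> inner e e = 1,
      forall e f, B e -> B f -> e <> f -> inner e f = 0 &
      forall x, (forall e, B e -> inner e x = 0) -> x = 0].

Definition hilbert_basis : set H := xget set0 orthonormal_basis.

(* The trace of a positive operator, with values in [0, +oo]. *)
Definition trace T : \bar R :=
  (\esum_(e in hilbert_basis) (complex.Re (inner e (T e)))%:E)%E.

Definition trace_class T : Prop :=
  bounded_operator T /\ (trace (abs_operator T) < +oo)%E.

Definition closed_subspace W : Prop :=
  [/\ closed W, W 0 & forall (a : R[i]) x y, W x -> W y -> W (a *: x + y)].

Definition proj W (x : H) : H :=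
  xget 0 [set y | W y /\ forall z, W z -> inner z (x - y) = 0].

Definition orthogonal_sum V (I : eqType) (s : seq I) (W : I -> set H) : Prop :=
  [/\ forall i, i \in s -> W i `<=` V,
      forall i j, i \in s -> j \in s -> i != j ->
        forall x y, W i x -> W j y -> inner x y = 0 &
      forall x, V x -> exists2 y : I -> H,
        forall i, i \in s -> W i (y i) & x = \sum_(i <- s) y i].

End Operators.

(* Measurable types of the library are inhabited, whence [has_ray]: there is
   at least one infinite path. *)
Record rooted_tree := RootedTree {
  node :> choiceType ;
  root_node : node ;
  ch : node -> seq node ;
  ch_uniq : forall w, uniq (ch w) ;
  ch_root : forall w, root_node \notin ch w ;
  ch_inj : forall v w w', v \in ch w -> v \in ch w' -> w = w' ;
  ch_reach : forall w, exists2 p : seq node,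
    path (fun u v => v \in ch u) root_node p & w = last root_node p ;
  has_ray : exists o : nat -> node,
    o 0%N = root_node /\ forall n, o n.+1 \in ch (o n)
}.
Arguments root_node {_}.
Arguments ch {_}.

Section Boundary.
Context (T : rooted_tree).

(* The nodes of depth n. *)
Fixpoint level (n : nat) : seq T :=
  if n is m.+1 then flatten [seq ch w | w <- level m] else [:: root_node].

Definition infinite_path (o : nat -> T) : Prop :=
  o 0%N = root_node /\ forall n, o n.+1 \in ch (o n).

Record boundary := Ray { ray :> nat -> T ; rayP : infinite_path ray }.

Definition boundary_point : boundary :=
  let: exist o oP := cid (has_ray T) in Ray oP.

HB.instance Definition _ := gen_eqMixin boundary.
HB.instance Definition _ := gen_choiceMixin boundary.
HB.instance Definition _ := isPointed.Build boundary boundary_point.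

Definition cyl (w : T) : set boundary := [set o | exists n, o n = w].

End Boundary.

(* The topology has the cylinders as a countable base, so the cylinders
   generate the Borel sigma-algebra. *)
Notation borel_boundary T := (g_sigma_algebraType (range (@cyl T))).

Section Packets.
Context {R : realType} {H : hilbertType R} {T : rooted_tree}.

Definition packet_decomposition (W : T -> set H) : Prop :=
  [/\ forall w, closed_subspace (W w),
      forall n, orthogonal_sum setT (level T n) W &
      forall w, orthogonal_sum (W w) (ch w) W].

Definition packet_content (W : T -> set H) (Rop : H -> H) (w : T) : H -> H :=
  sqrt_operator Rop \o proj (W w) \o sqrt_operator Rop.

Definition packet_density (W : T -> set H) (Rop : H -> H)
    (mu : {measure set (borel_boundary T) -> \bar R}) (x : H)
    (e : borel_boundary T -> R) : Prop :=
  [/\ mu.-integrable setT (EFin \o e),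
      {ae mu, forall o, 0 <= e o},
      forall w, inner x (packet_content W Rop w x)
                = (\int[mu]_(o in cyl w) e o)%:C &
      inner x (Rop x) = (\int[mu]_(o in setT) e o)%:C].

End Packets.

(* Main.v *)
From HB Require Import structures.
Require Import Defs.
From mathcomp Require Import all_boot all_order all_algebra.
From mathcomp Require Import all_classical all_reals all_analysis.
From mathcomp Require Import complex.
From mathcomp Require Import measurable_realfun ring lra.
Import Order.TTheory GRing.Theory Num.Theory.
Import numFieldNormedType.Exports.
Local Open Scope classical_set_scope.
Local Open Scope complex_scope.
Local Open Scope ring_scope.

Set Implicit Arguments.
Unset Strict Implicit.
Unset Printing Implicit Defensive.

(** Write [A] for the square root of the positive trace class operator [S] and
    [P w] for the projection on [W w]. The packet form
    [<x, C_w x> = |P w (A x)|^2] is additive over the children of [w] by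
    Pythagoras, and therefore so is the trace
    [tr C_w = sum_e |P w (A e)|^2], summed over the orthonormal basis [e].
    Each of the two is thus a nonnegative mass distribution on the nodes of the
    tree, and every such distribution comes from a finite Borel measure on the
    boundary ([tree_measure_exists]): subdivide an interval along the tree,
    following the masses, and send each of its points to the ray of intervals
    that contain it. Cylinders form a pi-system, so the measure is determined by
    its values on them ([cyl_measure_unique]). The masses [tr C_w] thus define
    the measure [mu] of the theorem.

    For the densities, let [nu_x] be the measure with masses [<x, C_w x>]. The
    Hilbert-Schmidt bound [hs_bound] gives
    [<x, C_w x> <= |x|^2 tr C_w]. The difference of the two sides is again a
    mass distribution, hence [nu_x <= |x|^2 mu] on all Borel sets
    ([cyl_dominates]), and [e_x] is the Radon-Nikodym derivative of [nu_x].
    The two sides of the parallelogram identity for the densities have the same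
    integrals over cylinders, because [x |-> |P w (A x)|^2] satisfies the
    parallelogram law, and integrals over cylinders determine a nonnegative
    function almost everywhere ([cyl_integral_ae_eq]).

    The operator theory behind this is elementary. Square roots are limits of
    the iteration [Y := (K + Y^2) / 2], which solves [(1 - Y)^2 = 1 - K] and
    whose increments are bounded by those of its scalar version. The limit commutes with everything that commutes with
    the operator, which makes positive roots unique, so that [|S| = S] and the
    trace of [S] is finite. An orthonormal basis exists by Zorn's lemma, and its
    span is dense by the projection argument of [nearest_limit]. The
    projections [P w] are read off the orthogonal decompositions. *)

(** * The real inner product *)

Section Geometry.
Context {R : realType} {H : hilbertType R}.
Implicit Types (x y z : H) (a t : R) (A B : H -> H).

Definition hnorm x : R := complex.Re `|x|.

(** The real part carries all the metric information, and by [inner_rinner] it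
    determines the whole inner product; its values live in the ordered field
    [R], where inequalities are easier to handle than in [R[i]]. *)
Definition rinner x y : R := complex.Re (inner x y).

Lemma innerDr x y z : inner x (y + z) = inner x y + inner x z.
Proof. by have := inner_linear x y z 1; rewrite scale1r mul1r. Qed.

Lemma innerr0 x : inner x 0 = 0.
Proof. by apply: (addIr (inner x 0)); rewrite -innerDr !add0r. Qed.

Lemma innerZr (c : R[i]) x y : inner x (c *: y) = c * inner x y.
Proof. by have := inner_linear x y 0 c; rewrite innerr0 !addr0. Qed.

Lemma rinnerC x y : rinner x y = rinner y x.
Proof. by rewrite /rinner (inner_conj x y); case: (inner x y). Qed.

Lemma rinnerDr x y z : rinner x (y + z) = rinner x y + rinner x z.
Proof. by rewrite /rinner innerDr raddfD. Qed.

Lemma rinnerDl x y z : rinner (y + z) x = rinner y x + rinner z x.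
Proof. by rewrite rinnerC rinnerDr !(rinnerC x). Qed.

Lemma rinnerZr a x y : rinner x (a%:C *: y) = a * rinner x y.
Proof.
by rewrite /rinner innerZr; case: (inner x y) => u v /=; rewrite mul0r subr0.
Qed.

Lemma rinnerZl a x y : rinner (a%:C *: x) y = a * rinner x y.
Proof. by rewrite rinnerC rinnerZr rinnerC. Qed.

Lemma rinnerNr x y : rinner x (- y) = - rinner x y.
Proof. by rewrite -scaleN1r -(rmorphN1 (real_complex R)) rinnerZr mulN1r. Qed.

Lemma rinnerNl x y : rinner (- x) y = - rinner x y.
Proof. by rewrite rinnerC rinnerNr rinnerC. Qed.

Definition rinnerE := (rinnerDr, rinnerDl, rinnerNr, rinnerNl, rinnerZr, rinnerZl).

Lemma inner_rinner x y : inner x y = rinner x y +i* - rinner x ('i%C *: y).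
Proof.
by rewrite /rinner innerZr; case: (inner x y) => u v /=; rewrite mul0r mul1r sub0r opprK.
Qed.

Lemma hnormE x : `|x| = (hnorm x)%:C.
Proof. by rewrite /hnorm RRe_real// ger0_real. Qed.

Lemma hnorm_ge0 x : 0 <= hnorm x.
Proof. by have := normr_ge0 x; rewrite hnormE ler0c. Qed.

Lemma hnorm_sqr x : hnorm x ^+ 2 = rinner x x.
Proof.
by rewrite /rinner inner_norm hnormE -rmorphXn.
Qed.

Lemma rinner_ge0 x : 0 <= rinner x x.
Proof. by rewrite -hnorm_sqr sqr_ge0. Qed.

Lemma hnorm_eq0 x : hnorm x = 0 -> x = 0.
Proof. by move=> x0; apply/eqP; rewrite -normr_eq0 hnormE x0. Qed.

Lemma rinner_eq0 x : rinner x x = 0 -> x = 0.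
Proof.
by rewrite -hnorm_sqr => /eqP; rewrite sqrf_eq0 => /eqP; exact: hnorm_eq0.
Qed.

Lemma hnorm0 : hnorm 0 = 0.
Proof. by rewrite /hnorm normr0. Qed.

Lemma hnormN x : hnorm (- x) = hnorm x.
Proof. by rewrite /hnorm normrN. Qed.

Lemma hnormB x y : hnorm (x - y) = hnorm (y - x).
Proof. by rewrite -hnormN opprB. Qed.

Lemma hnormD x y : hnorm (x + y) <= hnorm x + hnorm y.
Proof. by rewrite -lecR rmorphD/= -!hnormE ler_normD. Qed.

Lemma hnorm_trans y x z : hnorm (x - z) <= hnorm (x - y) + hnorm (y - z).
Proof. by rewrite -[x - z](subrKA y) hnormD. Qed.

Lemma hnormZ (c : R[i]) x : hnorm (c *: x) = complex.Re `|c| * hnorm x.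
Proof. by rewrite /hnorm normrZ hnormE normc_def -rmorphM. Qed.

Lemma hnormZr a x : 0 <= a -> hnorm (a%:C *: x) = a * hnorm x.
Proof. by move=> a0; rewrite hnormZ normc_def/= expr0n/= addr0 sqrtr_sqr ger0_norm. Qed.

Lemma discr_le0 (u v w : R) :
  (forall t, 0 <= u + 2 * t * v + t ^+ 2 * w) -> v ^+ 2 <= u * w.
Proof.
move=> q; have [w0|w0|w0] := ltgtP w 0.
(* For [w < 0] the polynomial is negative at [t + 1] or at [- (t + 1)]. *)
- have u0 : 0 <= u by have := q 0; rewrite mulr0 mul0r expr0n/= mul0r !addr0.
  pose t := (1 + u + v ^+ 2) / - w.
  have tw : t * w = - (1 + u + v ^+ 2) by rewrite /t; field; lra.
  have t0 : 0 < t by rewrite divr_gt0 ?oppr_gt0//; have := sqr_ge0 v; lra.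
  have h1 := q (t + 1); have h2 := q (- (t + 1)).
  exfalso; have : 0 <= u + (t + 1) ^+ 2 * w by lra.
  have -> : (t + 1) ^+ 2 * w = (t * w) * t + 2 * (t * w) + w by ring.
  rewrite tw; have := sqr_ge0 v; nra.
- have e : u * w + - v ^+ 2 = w * (u + 2 * (- v / w) * v + (- v / w) ^+ 2 * w).
    by field; lra.
  by rewrite -subr_ge0 e mulr_ge0// ltW.
- rewrite w0 mulr0; have [->|v0] := eqVneq v 0; first by rewrite expr0n.
  have := q (- (1 + u) / (2 * v)); rewrite w0 mulr0 addr0.
  have -> : 2 * (- (1 + u) / (2 * v)) * v = - (1 + u) by field.
  by lra.
Qed.

Definition symmetric_operator A := forall x y, rinner (A x) y = rinner x (A y).

(** The form [<x, A y>] may be degenerate, so the argument goes through the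
    discriminant of the nonnegative polynomial [<t y + x, A (t y + x)>] in [t]. *)
Lemma form_CauchySchwarz A x y : linear A -> symmetric_operator A ->
  (forall x, 0 <= rinner x (A x)) ->
  rinner x (A y) ^+ 2 <= rinner x (A x) * rinner y (A y).
Proof.
move=> Alin Asym Age0; apply: discr_le0 => t.
have := Age0 (t%:C *: y + x).
rewrite Alin !rinnerE -Asym (rinnerC _ y) [rinner x (A y)]rinnerC.
by rewrite (rinnerC (A y)) -[rinner y (A x)]Asym (rinnerC (A y)); lra.
Qed.

Lemma CauchySchwarz x y : rinner x y <= hnorm x * hnorm y.
Proof.
have [|xy0] := leP (rinner x y) 0.
  by move=> /le_trans; apply; rewrite mulr_ge0 ?hnorm_ge0.
rewrite -(@ler_pXn2r _ 2) ?nnegrE ?mulr_ge0 ?hnorm_ge0 ?(ltW xy0)//.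
have ilin : linear (fun z : H => z) by [].
have isym : symmetric_operator (fun z => z) by [].
by rewrite exprMn !hnorm_sqr; have := form_CauchySchwarz x y ilin isym rinner_ge0.
Qed.

Lemma hnormD_sqr x y :
  hnorm (x + y) ^+ 2 = hnorm x ^+ 2 + 2 * rinner x y + hnorm y ^+ 2.
Proof. by rewrite !hnorm_sqr !rinnerE (rinnerC y); ring. Qed.

Lemma parallelogram x y :
  hnorm (x + y) ^+ 2 + hnorm (x - y) ^+ 2 = 2 * (hnorm x ^+ 2 + hnorm y ^+ 2).
Proof. by rewrite !hnormD_sqr hnormN rinnerNr; ring. Qed.

End Geometry.

(** * Limits in a Hilbert space *)

Section Limits.
Context {R : realType} {H : hilbertType R}.
Implicit Types (x y z l : H) (u v : nat -> H) (A B : H -> H).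

(** Convergence of the real distances to [0]: this keeps all estimates in the
    real field, although the topology of [H] is a normed one over [R[i]]. *)
Definition hlim u l := (fun n => hnorm (u n - l)) @ \oo --> (0 : R).

Lemma hlim_squeeze (c : nat -> R) u l :
  (forall n, hnorm (u n - l) <= c n) -> c @ \oo --> (0 : R) -> hlim u l.
Proof.
move=> uc c0; apply: (@squeeze_cvgr _ _ _ _ (fun=> 0) c) => //; last exact: cvg_cst.
by near=> n; rewrite hnorm_ge0/=.
Unshelve. all: by end_near. Qed.

Lemma hlim_complete (c : nat -> R) u : c @ \oo --> (0 : R) ->
  (forall n m, (n <= m)%N -> hnorm (u m - u n) <= c n) -> exists l, hlim u l.
Proof.
move=> c0 uc.
have uballs : cauchy (u @ \oo).
  apply/cauchy_exP => e e0.
  have eE : e = (complex.Re e)%:C by rewrite RRe_real// gtr0_real.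
  have e'0 : 0 < complex.Re e by rewrite -ltcR -eE.
  have /cvgrPdist_lt/(_ _ e'0)[N _ cN] := c0.
  exists (u N) => //; exists N => // n /= Nn.
  rewrite -ball_normE/= hnormE eE ltcR hnormB.
  have := cN N (leqnn N); rewrite sub0r normrN => /ltr_normlW.
  exact/le_lt_trans/uc.
have ul : cvg (u @ \oo) by exact: cauchy_cvg.
exists (lim (u @ \oo)).
apply/cvgrPdist_lt => e e0.
have e'0 : 0 < e%:C :> R[i] by rewrite ltcR.
have /cvgrPdist_lt/(_ _ e'0)[N _ uN] := ul.
exists N => // n /= /uN /=; rewrite hnormE ltcR hnormB sub0r normrN.
by rewrite ger0_norm ?hnorm_ge0.
Qed.

Lemma hlim_unique u l l' : hlim u l -> hlim u l' -> l = l'.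
Proof.
move=> ul ul'; apply/eqP; rewrite -subr_eq0; apply/eqP/hnorm_eq0.
have h : (fun n => hnorm (u n - l) + hnorm (u n - l')) @ \oo --> (0 : R).
  by rewrite -[0]addr0; exact: cvgD.
apply/eqP; rewrite eq_le hnorm_ge0 andbT.
rewrite -(cvg_lim _ h)//; apply: limr_ge; first exact: cvgP h.
by near=> n; rewrite (hnormB (u n)) hnorm_trans.
Unshelve. all: by end_near. Qed.

Lemma hlim_lin (a : R[i]) u v l l' : hlim u l -> hlim v l' ->
  hlim (fun n => a *: u n + v n) (a *: l + l').
Proof.
move=> ul vl'.
apply: (@hlim_squeeze (fun n => complex.Re `|a| * hnorm (u n - l) + hnorm (v n - l'))).
  by move=> n; rewrite opprD addrACA -scalerBr -hnormZ hnormD.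
rewrite -[0]addr0; apply: cvgD => //.
by rewrite -[X in _ --> X](mulr0 (complex.Re `|a|)); apply: cvgM => //; exact: cvg_cst.
Qed.

Lemma hlim_bounded (M : R) A u l : linear A ->
  (forall x, hnorm (A x) <= M * hnorm x) -> hlim u l -> hlim (A \o u) (A l).
Proof.
move=> Alin AM ul.
apply: (@hlim_squeeze (fun n => M * hnorm (u n - l))).
  move=> n /=; apply: le_trans (AM _); rewrite addrC -scaleN1r -Alin.
  by rewrite scaleN1r addrC.
by rewrite -[X in _ --> X](mulr0 M); apply: cvgM => //; exact: cvg_cst.
Qed.

Lemma hlim_rinner x u l : hlim u l -> (rinner x \o u) @ \oo --> rinner x l.
Proof.
move=> ul; apply/subr_cvg0.
apply: (@squeeze_cvgr _ _ _ _ (fun n => - (hnorm x * hnorm (u n - l)))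
                              (fun n => hnorm x * hnorm (u n - l))).
- near=> n => /=; rewrite -rinnerNr -rinnerDr CauchySchwarz andbT.
  by rewrite lerNl -rinnerNr -(hnormN (u n - l)) CauchySchwarz.
- rewrite -oppr0; apply: cvgN; rewrite -[X in _ --> X](mulr0 (hnorm x)).
  by apply: cvgM => //; exact: cvg_cst.
- rewrite -[X in _ --> X](mulr0 (hnorm x)).
  by apply: cvgM => //; exact: cvg_cst.
Unshelve. all: by end_near. Qed.

Lemma hlim_hnorm u l : hlim u l -> (hnorm \o u) @ \oo --> hnorm l.
Proof.
move=> ul; apply/subr_cvg0.
apply: (@squeeze_cvgr _ _ _ _ (fun n => - hnorm (u n - l))
                              (fun n => hnorm (u n - l))) => //.
- near=> n => /=; have := hnormD (u n - l) l; have := hnormD (l - u n) (u n).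
  by rewrite !subrK hnormB => h1 h2; apply/andP; split; lra.
- by rewrite -oppr0; exact: cvgN.
Unshelve. all: by end_near. Qed.

Lemma hlim_hnorm_le u l (c : R) :
  hlim u l -> (forall n, hnorm (u n) <= c) -> hnorm l <= c.
Proof.
move=> /hlim_hnorm ul uc; rewrite -(cvg_lim _ ul)//.
apply: limr_le; first exact: cvgP ul.
by near=> n; exact: uc.
Unshelve. all: by end_near. Qed.

End Limits.

(** * Square roots of positive operators *)

Section SquareRoot.
Context {R : realType} {H : hilbertType R}.
Implicit Types (x y z : H) (A B K S : H -> H).

Lemma linD A : linear A -> forall x y, A (x + y) = A x + A y.
Proof. by move=> Alin x y; have := Alin 1 x y; rewrite !scale1r. Qed.

Lemma lin0 A : linear A -> A 0 = 0.
Proof. by move=> /linD AD; apply: (addIr (A 0)); rewrite -AD !add0r. Qed.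

Lemma linZ A : linear A -> forall a x, A (a *: x) = a *: A x.
Proof. by move=> Alin a x; rewrite -[a *: x]addr0 Alin lin0// addr0. Qed.

Lemma linB A : linear A -> forall x y, A (x - y) = A x - A y.
Proof. by move=> Alin x y; rewrite linD// -scaleN1r linZ// scaleN1r. Qed.

Lemma bounded_operatorP A : bounded_operator A <->
  linear A /\ exists2 M : R, 0 < M & forall x, hnorm (A x) <= M * hnorm x.
Proof.
split=> [[Alin [M AM]]|[Alin [M _ AM]]]; split=> //.
  exists (Num.max 1 M); first by rewrite lt_max ltr01.
  move=> x; have := AM x; rewrite !hnormE -rmorphM/= lecR => /le_trans; apply.
  by rewrite ler_wpM2r ?hnorm_ge0// le_max lexx orbT.
by exists M => x; rewrite !hnormE -rmorphM/= lecR.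
Qed.

Lemma rinner_il x y : rinner ('i%C *: x) y = - rinner x ('i%C *: y).
Proof.
rewrite rinnerC /rinner !innerZr (inner_conj x y).
by case: (inner x y) => a b /=; rewrite !mul0r !mul1r !sub0r !opprK.
Qed.

Lemma symmetric_im0 A x : linear A -> symmetric_operator A -> rinner x ('i%C *: A x) = 0.
Proof.
move=> Alin Asym; have := rinner_il x (A x).
by rewrite rinnerC Asym (linZ Alin); lra.
Qed.

(** Over the complex numbers a quadratic form determines its sesquilinear
    form: polarising the vanishing of [Im <x, A x>] at [x + i y] gives the
    symmetry of the real part of [<x, A y>]. *)
Lemma positive_symmetric A : positive_operator A -> symmetric_operator A.
Proof.
move=> [[Alin _] A0].
have im0 x : rinner x ('i%C *: A x) = 0.
  by have := ger0_Im (A0 x); rewrite inner_rinner/= => h; apply/eqP; rewrite -oppr_eq0 h.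
have alt x y : rinner x ('i%C *: A y) = - rinner y ('i%C *: A x).
  have := im0 (x + y).
  by rewrite (linD Alin) scalerDr rinnerDl !rinnerDr !im0; lra.
move=> x y; have := alt ('i%C *: y) x.
rewrite rinner_il (linZ Alin) !scalerA -expr2 sqr_i !scaleN1r !rinnerNr.
by rewrite !opprK (rinnerC y).
Qed.

Lemma positive_rinner_ge0 A x : positive_operator A -> 0 <= rinner x (A x).
Proof. by case=> _ /(_ x); rewrite inner_rinner lecE/= => /andP[]. Qed.

Lemma inner_ge0 A x : linear A -> symmetric_operator A -> 0 <= rinner x (A x) ->
  0 <= inner x (A x).
Proof.
by move=> Alin Asym h; rewrite inner_rinner symmetric_im0// oppr0 ler0c.
Qed.

(** Cauchy-Schwarz for the form of [K], applied to [K x] and [x], gives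
    [|K x|^4 <= |K x|^2 |x|^2]. *)
Lemma form_contraction K x : linear K -> symmetric_operator K ->
  (forall x, 0 <= rinner x (K x) <= hnorm x ^+ 2) -> hnorm (K x) <= hnorm x.
Proof.
move=> Klin Ksym K01.
have K0 y : 0 <= rinner y (K y) by case/andP: (K01 y).
have K1 y : rinner y (K y) <= hnorm y ^+ 2 by case/andP: (K01 y).
have := form_CauchySchwarz (K x) x Klin Ksym K0; rewrite -hnorm_sqr => cs.
have le : hnorm (K x) ^+ 2 ^+ 2 <= hnorm (K x) ^+ 2 * hnorm x ^+ 2.
  by apply: le_trans cs _; rewrite ler_pM.
have [->|Kx0] := eqVneq (hnorm (K x)) 0; first exact: hnorm_ge0.
have Kx : 0 < hnorm (K x) by rewrite lt0r Kx0 hnorm_ge0.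
by rewrite -(@ler_pXn2r _ 2) ?nnegrE ?hnorm_ge0// -(ler_pM2l (exprn_gt0 2 Kx)).
Qed.

(** A fixed point of [Y := (K + Y^2) / 2] solves [(1 - Y)^2 = 1 - K]. The scalar
    counterpart [sqrt_iter_bound], started at [0], increases and is at most
    [1]. By [sqrt_iter_step] it bounds the increments of the operator iteration
    in norm, which replaces the monotone convergence of operators. *)
Fixpoint sqrt_iter K (n : nat) x : H :=
  if n is m.+1 then (2^-1)%:C *: (K x + sqrt_iter K m (sqrt_iter K m x)) else 0.

Fixpoint sqrt_iter_bound (n : nat) : R :=
  if n is m.+1 then 2^-1 * (1 + sqrt_iter_bound m ^+ 2) else 0.

Local Notation t := sqrt_iter_bound.

Lemma sqrt_iter_bound01 n : 0 <= t n <= 1.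
Proof. by elim: n => [|n /andP[t0 t1]] /=; apply/andP; split=> //; nra. Qed.

Lemma sqrt_iter_bound_nd n : t n <= t n.+1.
Proof. by have /andP[_ t1] := sqrt_iter_bound01 n; rewrite /=; nra. Qed.

Section iteration.
Variable K : H -> H.
Hypotheses (Klin : linear K) (Ksym : symmetric_operator K).
Hypothesis K1 : forall x, hnorm (K x) <= hnorm x.
Local Notation Y := (sqrt_iter K).

Lemma sqrt_iter_lin n : linear (Y n).
Proof.
elim: n => [|n IH] a x y /=; first by rewrite scaler0 addr0.
by rewrite Klin !IH addrACA -(scalerDr a) [LHS]scalerDr !scalerA mulrC.
Qed.

Lemma sqrt_iter_sym n : symmetric_operator (Y n).
Proof.
elim: n => [|n IH] x y /=.
  by rewrite rinnerC -(scale0r x) -(rmorph0 (real_complex R)) !rinnerZr !mul0r.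
by rewrite rinnerZl rinnerZr rinnerDl rinnerDr Ksym !IH.
Qed.

Lemma sqrt_iter_le n x : hnorm (Y n x) <= t n * hnorm x.
Proof.
elim: n x => [|n IH] x /=; first by rewrite hnorm0 mul0r.
rewrite hnormZr ?invr_ge0// -mulrA ler_wpM2l ?invr_ge0//.
apply: le_trans (hnormD _ _) _; rewrite mulrDl mul1r lerD// expr2 -mulrA.
apply: le_trans (IH _) _; apply: ler_wpM2l => //.
by case/andP: (sqrt_iter_bound01 n).
Qed.

(** [Y_(n+1)^2 - Y_n^2] is [Y_(n+1) (Y_(n+1) - Y_n) + (Y_(n+1) - Y_n) Y_n]. *)
Lemma sqrt_iter_step n x : hnorm (Y n.+1 x - Y n x) <= (t n.+1 - t n) * hnorm x.
Proof.
elim: n x => [|n IH] x.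
  rewrite /= addr0 !subr0 hnormZr ?invr_ge0// expr0n/= addr0 mulr1.
  by rewrite ler_wpM2l ?invr_ge0.
have -> : Y n.+2 x - Y n.+1 x = (2^-1)%:C *:
    (Y n.+1 (Y n.+1 x - Y n x) + (Y n.+1 (Y n x) - Y n (Y n x))).
  rewrite (linB (sqrt_iter_lin _)) subrKA -[Y n.+2 x]/(_ *: _).
  by rewrite {2}[Y n.+1]/sqrt_iter -/sqrt_iter -scalerBr opprD addrACA subrr add0r.
rewrite hnormZr ?invr_ge0//.
have -> : t n.+2 - t n.+1 = 2^-1 * (t n.+1 * (t n.+1 - t n) + (t n.+1 - t n) * t n).
  by rewrite /=; field.
rewrite -mulrA ler_wpM2l ?invr_ge0// mulrDl; apply: le_trans (hnormD _ _) _.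
have /andP[tn0 _] := sqrt_iter_bound01 n.+1; have td := sqrt_iter_bound_nd n.
rewrite lerD//; apply: le_trans.
- exact: sqrt_iter_le.
- by rewrite -mulrA ler_wpM2l.
- exact: IH.
- by rewrite -mulrA ler_wpM2l ?subr_ge0// sqrt_iter_le.
Qed.

Lemma sqrt_iter_dist n m x : (n <= m)%N ->
  hnorm (Y m x - Y n x) <= (t m - t n) * hnorm x.
Proof.
move=> /subnK <-; elim: (m - n)%N => [|k IH].
  by rewrite !subrr hnorm0 mul0r.
rewrite addSn; apply: le_trans (hnorm_trans (Y (k + n) x) _ _) _.
rewrite -[_ - t n](subrKA (t (k + n))) mulrDl.
exact: lerD (sqrt_iter_step _ _) IH.
Qed.

Lemma sqrt_iter_cvg x : exists l, hlim (fun n => Y n x) l.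
Proof.
have tc : t @ \oo --> limn t.
  apply: nondecreasing_is_cvgn.
    by apply/nondecreasing_seqP; exact: sqrt_iter_bound_nd.
  by exists 1 => _ [n _ <-]; case/andP: (sqrt_iter_bound01 n).
apply: (@hlim_complete _ _ (fun n => (limn t - t n) * hnorm x)).
  rewrite -[X in _ --> X](mul0r (hnorm x)); apply: cvgM; last exact: cvg_cst.
  by rewrite -[X in _ --> X](subrr (limn t)); apply: cvgB => //; exact: cvg_cst.
move=> n m nm; apply: le_trans (sqrt_iter_dist x nm) _.
rewrite ler_wpM2r ?hnorm_ge0// lerB//; apply: nondecreasing_cvgn_le.
  by apply/nondecreasing_seqP; exact: sqrt_iter_bound_nd.
exact: cvgP tc.
Qed.

(** The last clause holds because each iterate is a polynomial in [K]; it is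
    what the uniqueness of square roots rests on. *)
Lemma sqrt_iter_lim : exists Z : H -> H,
  [/\ linear Z, symmetric_operator Z, forall x, hnorm (Z x) <= hnorm x,
      forall x, (2^-1)%:C *: (K x + Z (Z x)) = Z x &
      forall B, bounded_operator B -> B \o K = K \o B -> B \o Z = Z \o B].
Proof.
have /choice[Z YZ] := sqrt_iter_cvg; exists Z.
have Zlin : linear Z.
  move=> a x y; apply: (hlim_unique (YZ _)).
  have -> : (fun n => Y n (a *: x + y)) = (fun n => a *: Y n x + Y n y).
    by apply/funext => n; rewrite sqrt_iter_lin.
  exact: hlim_lin.
have Yle1 n x : hnorm (Y n x) <= hnorm x.
  apply: le_trans (sqrt_iter_le n x) _.
  by rewrite ler_piMl ?hnorm_ge0//; case/andP: (sqrt_iter_bound01 n).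
have Z1 x : hnorm (Z x) <= hnorm x by apply: (hlim_hnorm_le (YZ x)) => n.
split => //.
- move=> x y; have e : (rinner y \o (fun n => Y n x)) = (rinner x \o (fun n => Y n y)).
    by apply/funext => n /=; rewrite rinnerC sqrt_iter_sym.
  rewrite rinnerC; have := hlim_rinner (x := x) (YZ y); have := hlim_rinner (x := y) (YZ x).
  rewrite e => h1 h2; exact: (cvg_unique _ h1 h2).
- move=> x; apply: (@hlim_unique _ _ (fun n => Y n.+1 x)); last first.
    by have := YZ x; rewrite /hlim -(cvg_shiftS (fun n => hnorm (Y n x - Z x))).
  pose c n := 2^-1 * (hnorm (Y n x - Z x) + hnorm (Y n (Z x) - Z (Z x))).
  apply: (@hlim_squeeze _ _ c) => [n|].
    rewrite /= -scalerBr hnormZr ?invr_ge0// ler_wpM2l ?invr_ge0//.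
    rewrite opprD addrACA subrr add0r.
    apply: le_trans (hnorm_trans (Y n (Z x)) _ _) _; rewrite lerD2r.
    by rewrite -(linB (sqrt_iter_lin n)).
  rewrite -[X in _ --> X](mulr0 2^-1); apply: cvgM; first exact: cvg_cst.
  by rewrite -[0]addr0; apply: cvgD; exact: YZ.
- move=> B /bounded_operatorP[Blin [M _ BM]] BK; apply/funext => x /=.
  have BY n y : B (Y n y) = Y n (B y).
    elim: n y => [|n IH] y /=; first exact: lin0.
    by rewrite (linZ Blin) (linD Blin) -!IH -[B (K y)]/((B \o K) y) BK.
  apply: (hlim_unique (hlim_bounded Blin BM (YZ x))).
  have -> : (B \o (fun n => Y n x)) = (fun n => Y n (B x)) by apply/funext => n /=.
  exact: YZ.
Qed.

End iteration.

(** Scaling by a bound [M] of [S] makes [K = 1 - S / M] a positive contraction;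
    if [Z] is the limit of the iteration for [K], the root is
    [sqrt M (1 - Z)]. *)
Lemma sqrt_exists S : positive_operator S -> exists A,
  [/\ positive_operator A, A \o A = S &
      forall B, bounded_operator B -> B \o S = S \o B -> B \o A = A \o B].
Proof.
move=> Spos; have [Slin [M M0 SM]] := (bounded_operatorP S).1 Spos.1.
have Ssym := positive_symmetric Spos.
pose K x := x - (M^-1)%:C *: S x.
have Klin : linear K.
  move=> a x y; rewrite /K Slin scalerDr opprD addrACA scalerBr !scalerA.
  by rewrite [a * _]mulrC.
have Ksym : symmetric_operator K by move=> x y; rewrite /K !rinnerE Ssym.
have K01 x : 0 <= rinner x (K x) <= hnorm x ^+ 2.
  rewrite /K !rinnerE -hnorm_sqr subr_ge0 lerBlDr lerDl.
  rewrite mulr_ge0 ?invr_ge0 ?(ltW M0) ?positive_rinner_ge0// andbT.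
  rewrite mulrC ler_pdivrMr// (le_trans (CauchySchwarz _ _))//.
  by rewrite expr2 -mulrA ler_wpM2l ?hnorm_ge0// mulrC.
have [Z [Zlin Zsym Z1 ZE Zcomm]] := sqrt_iter_lim Klin Ksym
  (fun x => form_contraction x Klin Ksym K01).
pose c := (Num.sqrt M)%:C; pose A x := c *: (x - Z x).
have ccM : c * c = M%:C by rewrite -rmorphM/= -expr2 sqr_sqrtr// ltW.
have Alin : linear A.
  move=> a x y; rewrite /A Zlin opprD addrACA -scalerBr scalerDr !scalerA.
  by rewrite [a * _]mulrC.
have Asym : symmetric_operator A by move=> x y; rewrite /A !rinnerE Zsym.
exists A; split.
- split; first (apply/bounded_operatorP; split=> //).
    exists (2 * Num.sqrt M); first by rewrite mulr_gt0// sqrtr_gt0.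
    move=> x; rewrite /A hnormZr ?sqrtr_ge0// (mulrC 2) -mulrA ler_wpM2l ?sqrtr_ge0//.
    by apply: le_trans (hnormD _ _) _; rewrite hnormN; have := Z1 x; lra.
  move=> x; apply: inner_ge0 => //; rewrite /A !rinnerE mulr_ge0 ?sqrtr_ge0//.
  rewrite subr_ge0 (le_trans (CauchySchwarz _ _))// -hnorm_sqr expr2.
  by rewrite ler_wpM2l ?hnorm_ge0.
- apply/funext => x; rewrite /= /A (linZ Zlin) (linB Zlin) -scalerBr scalerA ccM.
  have -> : x - Z x - (Z x - Z (Z x)) = x - (Z x + Z x) + Z (Z x).
    by rewrite opprB opprD addrA addrA addrAC.
  have -> : Z x + Z x = K x + Z (Z x).
    rewrite -{1 2}ZE -scalerDl -rmorphD/= -[X in X%:C](_ : 1 = _) ?scale1r//.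
    by field.
  rewrite /K opprD addrA subrK opprB addrC subrK scalerA -rmorphM/= divff ?scale1r//.
  by rewrite gt_eqF.
- move=> B Bb BS; have [Blin _] := Bb; apply/funext => x; rewrite /= /A (linZ Blin) (linB Blin).
  have BK : B \o K = K \o B.
    apply/funext => y; rewrite /= /K (linB Blin) (linZ Blin).
    by rewrite -[B (S y)]/((B \o S) y) BS.
  by rewrite -[B (Z x)]/((B \o Z) x) (Zcomm B Bb BK).
Qed.

End SquareRoot.

(** * Uniqueness of positive square roots *)

Section PositiveOperators.
Context {R : realType} {H : hilbertType R}.
Implicit Types (x y z : H) (A B S : H -> H).

(** Cauchy-Schwarz for the form of [A], applied to [A x] and [x]. *)
Lemma positive_form_eq0 A x : positive_operator A -> rinner x (A x) = 0 -> A x = 0.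
Proof.
move=> Apos x0; apply: rinner_eq0; apply/eqP; rewrite -sqrf_eq0 eq_le sqr_ge0 andbT.
have [[Alin _] _] := Apos.
have := form_CauchySchwarz (A x) x Alin (positive_symmetric Apos)
  (fun y => positive_rinner_ge0 y Apos).
by rewrite x0 mulr0.
Qed.

(** If [A] and [B] commute and have the same square, then [A] and [B] have zero
    form at every vector [y = (A - B) x], because [(A + B) y = 0]; so [A] and
    [B] kill [y], and [|y|^2 = <x, (A - B) y> = 0]. *)
Lemma commuting_sqrt_eq A B : positive_operator A -> positive_operator B ->
  A \o A = B \o B -> B \o A = A \o B -> A = B.
Proof.
move=> Apos Bpos AB com; apply/funext => x; apply/eqP; rewrite -subr_eq0; apply/eqP.
have [[Alin _] _] := Apos; have [[Blin _] _] := Bpos.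
pose y := A x - B x.
have y0 : A y + B y = 0.
  rewrite /y (linB Alin) (linB Blin) -[A (A x)]/((A \o A) x) AB.
  by rewrite -[B (A x)]/((B \o A) x) com /= addrC subrKA subrr.
have ge0 := (positive_rinner_ge0 y Apos, positive_rinner_ge0 y Bpos).
have sum0 : rinner y (A y) + rinner y (B y) = 0.
  by rewrite -rinnerDr y0 -(subrr y) rinnerDr rinnerNr subrr.
have Ay0 : A y = 0 by apply: positive_form_eq0 => //; move: ge0 => []; lra.
have By0 : B y = 0 by apply: positive_form_eq0 => //; move: ge0 => []; lra.
apply: rinner_eq0; rewrite -/y {1}/y rinnerDl rinnerNl.
by rewrite (positive_symmetric Apos) (positive_symmetric Bpos) Ay0 By0 subrr.
Qed.

Lemma square_positive A : positive_operator A -> positive_operator (A \o A).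
Proof.
move=> Apos; have [[Alin _] _] := Apos; have Asym := positive_symmetric Apos.
have [_ [M M0 AM]] := (bounded_operatorP A).1 Apos.1.
have AAlin : linear (A \o A) by move=> a x y /=; rewrite !Alin.
split.
  apply/bounded_operatorP; split=> //; exists (M * M); first exact: mulr_gt0.
  move=> x; rewrite -mulrA; apply: le_trans (AM _) _.
  by rewrite ler_wpM2l ?(ltW M0).
move=> x; apply: inner_ge0 => //.
  by move=> u v; rewrite /= !Asym.
by rewrite /= -Asym rinner_ge0.
Qed.

(** Two arbitrary roots need not commute a priori; both are compared with the
    constructed root [C], which commutes with each of them. *)
Lemma positive_sqrt_unique A B : positive_operator A -> positive_operator B ->
  A \o A = B \o B -> A = B.
Proof.
move=> Apos Bpos AB.
have [C [Cpos CC com]] := sqrt_exists (square_positive Apos).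
have comA : A \o C = C \o A by apply: com; [exact: Apos.1|].
have comB : B \o C = C \o B.
  by apply: com; [exact: Bpos.1|apply/funext => x; rewrite AB].
rewrite -(commuting_sqrt_eq Cpos Apos CC comA).
by apply: commuting_sqrt_eq => //; rewrite CC.
Qed.

Lemma sqrt_operatorP S : positive_operator S ->
  positive_operator (sqrt_operator S) /\ sqrt_operator S \o sqrt_operator S = S.
Proof.
move=> /sqrt_exists[A [Apos AA _]].
by apply: (@xgetPex _ (fun=> 0) [set B | positive_operator B /\ B \o B = S]); exists A.
Qed.

Lemma symmetric_inner A x y : linear A -> symmetric_operator A -> inner (A x) y = inner x (A y).
Proof. by move=> Alin Asym; rewrite !inner_rinner !Asym (linZ Alin). Qed.

(** By symmetry [S] is itself an adjoint, and adjoints are unique; so the choice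
    behind [adjoint] finds [S] without a representation theorem. *)
Lemma adjoint_positive S : positive_operator S -> adjoint S = S.
Proof.
move=> Spos; have [[Slin _] _] := Spos; have Ssym := positive_symmetric Spos.
have [_ adj] : [set B | bounded_operator B /\
    forall x y, inner (S x) y = inner x (B y)] (adjoint S).
  by apply: xgetPex; exists S; split; [exact: Spos.1|move=> x y; exact: symmetric_inner].
apply/funext => y; apply/eqP; rewrite -subr_eq0; apply/eqP/rinner_eq0.
set z := adjoint S y - S y.
have : inner z (adjoint S y) = inner z (S y) by rewrite -adj symmetric_inner.
by rewrite {4}/z rinnerDr rinnerNr /rinner => ->; rewrite subrr.
Qed.

Lemma abs_operator_positive S : positive_operator S -> abs_operator S = S.
Proof.
move=> Spos; rewrite /abs_operator adjoint_positive//.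
have [pos eq] := sqrt_operatorP (square_positive Spos).
exact: positive_sqrt_unique.
Qed.

End PositiveOperators.

(** * Orthonormal bases *)

Section OrthonormalBasis.
Context {R : realType} {H : hilbertType R}.
Implicit Types (x y z e : H) (B V : set H).

Definition orthonormal B := (forall e, B e -> inner e e = 1) /\
  (forall e f, B e -> B f -> e <> f -> inner e f = 0).

(** A maximal orthonormal set is total: a vector orthogonal to it could be
    normalised and added. *)
Lemma orthonormal_basis_exists : exists B : set H, orthonormal_basis B.
Proof.
have [F Fo Ftot|B [Bo Bmax]] := @Zorn_bigcup H orthonormal.
  split=> [e [X FX Xe]|e f [X FX Xe] [Y FY Yf]]; first exact: (Fo _ FX).1.
  by have [XY|YX] := Ftot X Y FX FY;
    [apply: (Fo _ FY).2 => //; exact: XY|apply: (Fo _ FX).2 => //; exact: YX].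
exists B; have [B1 B0] := Bo; split=> // x xB; apply: contrapT => x0.
have hx0 : hnorm x != 0 by apply/eqP => /hnorm_eq0.
pose u := ((hnorm x)^-1)%:C *: x.
have uu : inner u u = 1.
  rewrite inner_norm hnormE hnormZr ?invr_ge0 ?hnorm_ge0// mulVf//.
  by rewrite rmorph1 expr1n.
have uB e : B e -> inner e u = 0 by move=> Be; rewrite innerZr xB// mulr0.
have Bu e : B e -> inner u e = 0 by move=> Be; rewrite inner_conj uB// conjC0.
apply: (Bmax (B `|` [set u])).
  split; first by move=> e Be; left.
  move=> BB; have /uB := BB _ (or_intror erefl); rewrite uu => /eqP.
  by rewrite oner_eq0.
split=> [e [/B1|->]|e f [Be|->] [Bf|->]] //; [exact: B0|by rewrite uB|by rewrite Bu].
Qed.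

Lemma hilbert_basisP : orthonormal_basis (@hilbert_basis R H).
Proof. by apply: xgetPex; exact: orthonormal_basis_exists. Qed.


End OrthonormalBasis.

(** * Density of the span and the Hilbert-Schmidt bound *)

Section Density.
Context {R : realType} {H : hilbertType R}.
Implicit Types (x y z e : H) (B V : set H) (A : H -> H).

(** A minimising sequence for the distance from [x] to [V] is Cauchy by the
    parallelogram law, and its limit is the foot of a perpendicular. *)
Lemma nearest_limit V x : V 0 ->
  (forall (a : R[i]) y z, V y -> V z -> V (a *: y + z)) ->
  exists z, exists2 u : nat -> H, (forall n, V (u n)) &
    hlim u z /\ forall v, V v -> rinner v (x - z) = 0.
Proof.
move=> V0 Vlin; pose D := [set hnorm (x - v) ^+ 2 | v in V].
have Dinf : has_inf D.
  by split; [exists (hnorm (x - 0) ^+ 2), 0|exists 0 => _ [v _ <-]; exact: sqr_ge0].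
pose d := inf D; pose h (n : nat) : R := n.+1%:R^-1.
have h0 n : 0 < h n by rewrite invr_gt0.
have dV v : V v -> d <= hnorm (x - v) ^+ 2.
  by move=> Vv; apply: ge_inf; [exact: Dinf.2|exists v].
have /choice[u uP] : forall n, exists v, V v /\ hnorm (x - v) ^+ 2 < d + h n ^+ 2.
  move=> n; have [_ [v Vv <-] lt] := inf_adherent (exprn_gt0 2 (h0 n)) Dinf.
  by exists v.
have uV n : V (u n) by case: (uP n).
have ud n : hnorm (x - u n) ^+ 2 <= d + h n ^+ 2 by apply/ltW; case: (uP n).
have cauchy n m : (n <= m)%N -> hnorm (u m - u n) <= 2 * h n.
  move=> nm; have hmn : h m <= h n by rewrite lef_pV2 ?posrE// ler_nat.
  have mid : V ((2^-1)%:C *: (u m + u n)).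
    rewrite -[_ *: _]addr0; apply: (Vlin _ _ _ _ V0).
    by rewrite -[u m]scale1r; exact: Vlin.
  have := parallelogram (x - u m) (x - u n).
  have -> : x - u m + (x - u n) = (2%:R)%:C *: (x - (2^-1)%:C *: (u m + u n)).
    rewrite scalerBr scalerA -rmorphM/= divff// scale1r rmorph_nat scaler_nat mulr2n.
    by rewrite opprD addrACA.
  have -> : x - u m - (x - u n) = - (u m - u n) by rewrite opprB addrC subrKA opprB.
  rewrite hnormN hnormZr// exprMn => pl.
  rewrite -(@ler_pXn2r _ 2) ?nnegrE ?hnorm_ge0 ?mulr_ge0 ?(ltW (h0 n))//.
  have := dV _ mid; have := ud m; have := ud n.
  have : h m ^+ 2 <= h n ^+ 2 by rewrite ler_pXn2r ?nnegrE ?(ltW (h0 _)).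
  by rewrite exprMn; lra.
have hlim0 : h @ \oo --> (0 : R) by exact: cvg_harmonic.
have [z uz] : exists z, hlim u z.
  apply: (@hlim_complete _ _ (fun n => 2 * h n)) => //.
  by rewrite -[X in _ --> X](mulr0 2); apply: cvgM => //; exact: cvg_cst.
exists z, u => //; split=> // v Vv.
have bound n : `|rinner v (x - u n)| <= h n * hnorm v.
  rewrite -(@ler_pXn2r _ 2) ?nnegrE ?mulr_ge0 ?hnorm_ge0 ?(ltW (h0 n))//.
  rewrite real_normK ?num_real// exprMn; apply: discr_le0 => t.
  have Vt : V ((- t)%:C *: v + u n) by exact: Vlin.
  have := dV _ Vt; have := ud n.
  have -> : x - ((- t)%:C *: v + u n) = (x - u n) + t%:C *: v.
    by rewrite opprD rmorphN/= scaleNr opprK addrCA addrC.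
  rewrite (hnormD_sqr (x - u n)) rinnerZr (hnorm_sqr (_ *: v)) rinnerZl rinnerZr -(hnorm_sqr v).
  rewrite (rinnerC _ v).
  by lra.
have lim1 : (fun n => rinner v (x - u n)) @ \oo --> rinner v (x - z).
  have -> : (fun n => rinner v (x - u n)) = (fun n => rinner v x - rinner v (u n)).
    by apply/funext => n; rewrite rinnerDr rinnerNr.
  rewrite rinnerDr rinnerNr; apply: cvgB; first exact: cvg_cst.
  exact: hlim_rinner uz.
have lim0 : (fun n => rinner v (x - u n)) @ \oo --> (0 : R).
  have hv0 : (fun n => h n * hnorm v) @ \oo --> (0 : R).
    by rewrite -[X in _ --> X](mul0r (hnorm v)); apply: cvgM => //; exact: cvg_cst.
  apply: (@squeeze_cvgr _ _ _ _ (fun n => - (h n * hnorm v)) (fun n => h n * hnorm v)) => //.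
  - by near=> n; rewrite -ler_norml.
  - by rewrite -oppr0; exact: cvgN.
exact: (cvg_unique _ lim1 lim0).
Unshelve. all: by end_near. Qed.

(** Finite sums over repetition-free lists, so that [hs_bound_span] can use
    orthogonality term by term. *)
Definition hspan B : set H := [set y | exists s : seq H, exists c : H -> R[i],
  [/\ uniq s, forall e, e \in s -> B e & y = \sum_(e <- s) c e *: e]].

Lemma hspan0 B : hspan B 0.
Proof. by exists [::], (fun=> 0); split=> //; rewrite big_nil. Qed.

Lemma big_seq_extend (s s' : seq H) (F : H -> H) : uniq s -> uniq s' ->
  {subset s <= s'} -> \sum_(e <- s) F e = \sum_(e <- s' | e \in s) F e.
Proof.
move=> us us' ss'; rewrite -[RHS]big_filter; apply: perm_big; apply: uniq_perm => //.
  exact: filter_uniq.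
by move=> e; rewrite mem_filter; case: (boolP (e \in s)) => // /ss' ->.
Qed.

Lemma hspan_lin B (a : R[i]) y z : hspan B y -> hspan B z -> hspan B (a *: y + z).
Proof.
move=> [s [c [us sB ->]]] [s' [c' [us' sB' ->]]].
pose S := undup (s ++ s').
pose C e := a * (if e \in s then c e else 0) + (if e \in s' then c' e else 0).
exists S, C; split; first exact: undup_uniq.
  by move=> e; rewrite mem_undup mem_cat => /orP[/sB|/sB'].
rewrite (@big_seq_extend s S)// ?undup_uniq//; last first.
  by move=> e es; rewrite mem_undup mem_cat es.
rewrite (@big_seq_extend s' S)// ?undup_uniq//; last first.
  by move=> e es; rewrite mem_undup mem_cat es orbT.
rewrite scaler_sumr [X in X + _]big_mkcond [X in _ + X]big_mkcond -big_split; apply: eq_bigr => e _ /=.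
rewrite /C scalerDl -scalerA.
by case: (e \in s); case: (e \in s'); rewrite ?scale0r ?scaler0.
Qed.

Lemma hspan_mem B e : B e -> hspan B e.
Proof.
move=> Be; exists [:: e], (fun=> 1); split=> //; last by rewrite big_seq1 scale1r.
by move=> f; rewrite inE => /eqP ->.
Qed.

(** The foot of the perpendicular from [x] to the span differs from [x] by a
    vector orthogonal to the basis. *)
Lemma hspan_dense B x : orthonormal_basis B ->
  exists2 u : nat -> H, (forall n, hspan B (u n)) & hlim u x.
Proof.
move=> [_ _ Btot]; have [z [u uB [uz xz]]] := nearest_limit x (hspan0 B) (@hspan_lin B).
suff -> : x = z by exists u.
apply/eqP; rewrite -subr_eq0; apply/eqP; apply: Btot => e /hspan_mem Be.
rewrite inner_rinner -rinner_il !xz//.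
by rewrite -[_ *: e]addr0; apply: hspan_lin => //; exact: hspan0.
Qed.

Lemma inner_sumr x (I : Type) (s : seq I) (F : I -> H) :
  inner x (\sum_(e <- s) F e) = \sum_(e <- s) inner x (F e).
Proof.
by elim/big_rec2 : _ => [|e a b _ IH]; rewrite ?innerr0// innerDr IH.
Qed.

(** The Hilbert-Schmidt bound on the span of an orthonormal set, by induction
    on the number of basis vectors and Cauchy-Schwarz in the plane. *)
Lemma hs_bound_span B A (s : seq H) (c : H -> R[i]) : orthonormal B -> linear A ->
  uniq s -> (forall e, e \in s -> B e) ->
  hnorm (A (\sum_(e <- s) c e *: e)) ^+ 2 <=
  hnorm (\sum_(e <- s) c e *: e) ^+ 2 * \sum_(e <- s) hnorm (A e) ^+ 2.
Proof.
move=> [B1 B0] Alin; elim: s => [_ _|e s IH /= /andP[es us] sB].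
  by rewrite !big_nil lin0// hnorm0 expr0n mul0r.
have {}IH := IH us (fun f fs => sB f (mem_behead (s := e :: s) fs)).
have Be : B e by apply: sB; rewrite mem_head.
rewrite !big_cons (linD Alin) (linZ Alin).
set y := \sum_(f <- s) c f *: f in IH *; set q := \sum_(f <- s) _ in IH *.
have ey : inner e y = 0.
  rewrite inner_sumr big1_seq// => f /andP[_ fs]; rewrite innerZr B0 ?mulr0//.
    by apply: sB; rewrite inE fs orbT.
  by move=> ef; rewrite ef fs in es.
have ye : rinner (c e *: e) y = 0.
  by rewrite rinnerC /rinner innerZr inner_conj ey conjC0 mulr0.
have e1 : hnorm e = 1.
  apply/eqP; rewrite -(@eqrXn2 _ 2) ?hnorm_ge0// hnorm_sqr /rinner B1//.
  by rewrite expr1n.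
rewrite (hnormD_sqr (c e *: e)) ye mulr0 addr0 (hnormZ _ e) e1 mulr1.
set k := complex.Re `|c e|.
have k0 : 0 <= k by rewrite /k -(mulr1 (complex.Re _)) -e1 -hnormZ hnorm_ge0.
have q0 : 0 <= q by apply: sumr_ge0 => f _; exact: sqr_ge0.
set p := hnorm y in IH *; have p0 : 0 <= p := hnorm_ge0 y.
set a := hnorm (A e); have a0 : 0 <= a := hnorm_ge0 _.
have ler : hnorm (c e *: A e + A y) <= k * a + p * Num.sqrt q.
  apply: le_trans (hnormD _ _) _; rewrite (hnormZ _ (A e)) lerD2l.
  rewrite -(@ler_pXn2r _ 2) ?nnegrE ?mulr_ge0 ?hnorm_ge0 ?sqrtr_ge0//.
  by rewrite exprMn sqr_sqrtr.
apply: (@le_trans _ _ ((k * a + p * Num.sqrt q) ^+ 2)).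
  by rewrite ler_pXn2r ?nnegrE ?hnorm_ge0// (le_trans (hnorm_ge0 _) ler).
rewrite -{2}(sqr_sqrtr q0) -subr_ge0.
(* Lagrange's identity in the plane. *)
rewrite [leRHS](_ : _ = (k * Num.sqrt q - p * a) ^+ 2) ?sqr_ge0//.
by ring.
Qed.

(** The Hilbert-Schmidt norm dominates the operator norm. For
    [A = P_w S^(1/2)] this dominates [<x, C_w x>] by [|x|^2 tr C_w]. *)
Lemma hs_bound (m : R) A x : bounded_operator A ->
  (\esum_(e in @hilbert_basis R H) (hnorm (A e) ^+ 2)%:E = m%:E)%E ->
  hnorm (A x) ^+ 2 <= hnorm x ^+ 2 * m.
Proof.
move=> /bounded_operatorP[Alin [M _ AM]] sm.
have Bb := @hilbert_basisP R H; have [B1 B0 _] := Bb.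
have m0 : 0 <= m by rewrite -lee_fin -sm; apply: esum_ge0 => e _; rewrite lee_fin sqr_ge0.
have spanA y : hspan (@hilbert_basis R H) y -> hnorm (A y) <= hnorm y * Num.sqrt m.
  move=> [s [c [us sB ->]]].
  rewrite -(@ler_pXn2r _ 2) ?nnegrE ?mulr_ge0 ?hnorm_ge0 ?sqrtr_ge0//.
  rewrite exprMn sqr_sqrtr//; apply: le_trans (hs_bound_span c _ Alin us sB) _ => //.
  rewrite ler_wpM2l ?sqr_ge0// -lee_fin -sm -sumEFin; apply: esum_ge.
  exists [set` s]; first by split=> //; exact: finite_seq.
  by rewrite -fsbig_seq.
have [u uV ux] := hspan_dense x Bb.
have Au := hlim_hnorm (hlim_bounded Alin AM ux).
have -> : hnorm x ^+ 2 * m = (hnorm x * Num.sqrt m) ^+ 2 by rewrite exprMn sqr_sqrtr.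
rewrite ler_pXn2r ?nnegrE ?mulr_ge0 ?hnorm_ge0 ?sqrtr_ge0//.
apply: (ler_cvg_to Au).
  by apply: cvgM; [exact: hlim_hnorm ux|exact: cvg_cst].
by near=> n => /=; exact: spanA.
Unshelve. all: by end_near. Qed.

End Density.

(** * The tree and the packet projections *)

Section Levels.
Context {T : rooted_tree}.
Implicit Types (u v w : T).

Lemma mem_levelS n w :
  reflect (exists2 u, u \in level T n & w \in ch u) (w \in level T n.+1).
Proof. exact: flatten_mapP. Qed.

Lemma level_exists w : exists n, w \in level T n.
Proof.
have [p + ->] := ch_reach w; elim/last_ind: p => [_|p v IH].
  by exists 0%N; rewrite mem_head.
rewrite rcons_path last_rcons => /andP[/IH[n pn] vp].
by exists n.+1; apply/mem_levelS; exists (last root_node p).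
Qed.

(** Every node has one parent and the root has none. *)
Lemma level_unique n m w : w \in level T n -> w \in level T m -> n = m.
Proof.
elim: n m w => [|n IH] [|m] w //.
- rewrite inE => /eqP -> /mem_levelS[u _ uch].
  by have := ch_root u; rewrite uch.
- move=> /mem_levelS[u _ uch]; rewrite inE => /eqP weq.
  by have := ch_root u; rewrite -weq uch.
- move=> /mem_levelS[u un wu] /mem_levelS[v vm wv]; congr _.+1.
  by apply: (IH _ u) => //; rewrite (ch_inj wu wv).
Qed.

End Levels.

Section Packets.
Context {R : realType} {H : hilbertType R}.
Implicit Types (x y z : H) (V : set H) (A : H -> H).

(** The projection is defined by choice and means something only where a vector
    of this kind exists; here the decompositions provide it. *)
Definition is_proj V x y := V y /\ forall z, V z -> inner z (x - y) = 0.

Lemma innerBr x y z : inner x (y - z) = inner x y - inner x z.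
Proof. by rewrite innerDr -scaleN1r innerZr mulN1r. Qed.

Lemma is_proj_unique V x y y' : closed_subspace V ->
  is_proj V x y -> is_proj V x y' -> y = y'.
Proof.
move=> [_ _ Vlin] [Vy yx] [Vy' y'x]; apply/eqP; rewrite -subr_eq0; apply/eqP.
have Vd : V (y - y') by rewrite addrC -scaleN1r; exact: Vlin.
apply: rinner_eq0; rewrite /rinner -[y in inner _ (y - _)](subKr x) addrAC innerBr.
by rewrite yx// y'x// subrr.
Qed.

Lemma projE V x y : closed_subspace V -> is_proj V x y -> Defs.proj V x = y.
Proof.
move=> Vsub xy; apply: (is_proj_unique Vsub) (xy).
by apply: (@xgetPex _ 0 (is_proj V x)); exists y.
Qed.

(** Along a summand of an orthogonal decomposition the component is the
    projection, without any appeal to completeness. A summand listed several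
    times contributes its whole share. *)
Lemma orthogonal_sum_proj V (I : eqType) (s : seq I) (U : I -> set H) i x :
  (forall j, closed_subspace (U j)) -> orthogonal_sum V s U -> i \in s -> V x ->
  exists y, is_proj (U i) x y.
Proof.
move=> Usub [_ Uorth Udec] is_ Vx; have [y Uy xE] := Udec x Vx.
have [_ U0 Ulin] := Usub i.
exists (\sum_(j <- s | j == i) y j); split.
  elim/big_ind : _ => // [a b Ua Ub|j /eqP ->]; last exact: Uy.
  by rewrite -[a]scale1r; exact: Ulin.
move=> z Uz; rewrite xE (bigID (pred1 i))/= addrAC subrr add0r.
rewrite big_seq_cond; elim/big_rec: _ => [|j a /andP[js ji] IH]; first exact: innerr0.
by rewrite innerDr IH addr0; apply: (Uorth i j) => //; [rewrite eq_sym|exact: Uy].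
Qed.

Context {T : rooted_tree} (W : T -> set H) (hW : packet_decomposition W).
Local Notation P w := (Defs.proj (W w)).

Let Wsub w : closed_subspace (W w). Proof. by case: hW. Qed.

Lemma projP w x : is_proj (W w) x (P w x).
Proof.
have [n wn] := level_exists w; have [_ hn _] := hW.
have [y xy] := orthogonal_sum_proj Wsub (hn n) wn (I : setT x).
by rewrite (projE (Wsub w) xy).
Qed.

Lemma proj_lin w : linear (P w).
Proof.
move=> a x y; apply: (projE (Wsub w)); have [_ _ Wlin] := Wsub w.
have [Wx px] := projP w x; have [Wy py] := projP w y.
split; first exact: Wlin.
move=> z Wz; rewrite opprD addrACA -scalerBr innerDr innerZr px// py//.
by rewrite mulr0 addr0.
Qed.

Lemma proj_root x : P root_node x = x.
Proof.
have [_ h0 _] := hW; apply: (projE (Wsub _)); split; last first.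
  by move=> z _; rewrite subrr innerr0.
have [_ _ dec] := h0 0%N; have [y Wy ->] := dec x (I : setT x).
by rewrite big_seq1; apply: Wy; rewrite mem_head.
Qed.

Lemma inner_proj w x : inner x (P w x) = (hnorm (P w x) ^+ 2)%:C.
Proof.
have [Wx px] := projP w x; rewrite rmorphXn/= -hnormE -inner_norm.
have e : inner (P w x) x = inner (P w x) (P w x).
  by apply: subr0_eq; rewrite -innerBr px.
by rewrite inner_conj e -inner_conj.
Qed.

Lemma proj_le w x : hnorm (P w x) <= hnorm x.
Proof.
have := CauchySchwarz x (P w x).
rewrite /rinner inner_proj/= expr2.
have [->|p0] := eqVneq (hnorm (P w x)) 0; first by rewrite hnorm_ge0.
by rewrite ler_pM2r// lt0r p0 hnorm_ge0.
Qed.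

(** Pythagoras: the projection of [x] on the child [v] is the component along
    [W v] of the projection of [x] on [W w]. *)
Lemma proj_children w x :
  hnorm (P w x) ^+ 2 = \sum_(v <- ch w) hnorm (P v x) ^+ 2.
Proof.
have [_ _ /(_ w)[Wincl Worth Wdec]] := hW.
have [Wx px] := projP w x; have [y Wy xE] := Wdec _ Wx.
have uch := ch_uniq w.
have yE v : v \in ch w -> P v x = y v.
  move=> vw; apply: (projE (Wsub v)); split; first exact: Wy.
  move=> z Wz; rewrite -(subrKA (P w x)) innerDr px ?add0r; last exact: (Wincl v).
  rewrite xE (bigD1_seq v)//= addrAC subrr add0r.
  rewrite big_seq_cond; elim/big_rec: _ => [|u a /andP[uw uv] IH].
    exact: innerr0.
  by rewrite innerDr IH addr0; apply: (Worth v u) => //; [rewrite eq_sym|exact: Wy].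
rewrite -[LHS]/(complex.Re (hnorm (P w x) ^+ 2)%:C) -inner_proj {1}xE.
rewrite inner_sumr raddf_sum/=; apply: eq_big_seq => v vw.
by rewrite -yE// inner_proj.
Qed.

End Packets.

(** * Packet contents and their traces *)

Section PacketContent.
Context {R : realType} {H : hilbertType R} {T : rooted_tree}.
Variables (W : T -> set H) (S : H -> H).
Hypotheses (hW : packet_decomposition W) (Spos : positive_operator S).
Implicit Types (x y : H) (w : T).

(** This is [<x, C_w x>], by [inner_packet_content]. Written as a squared norm
    it is visibly nonnegative, quadratic in [x], and additive over children. *)
Definition packet_form w x : R := hnorm (Defs.proj (W w) (sqrt_operator S x)) ^+ 2.

Let Apos := (sqrt_operatorP Spos).1.
Let Alin := Apos.1.1.

Lemma inner_packet_content w x :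
  inner x (packet_content W S w x) = (packet_form w x)%:C.
Proof.
rewrite /packet_content/= -symmetric_inner ?inner_proj//.
exact: positive_symmetric.
Qed.

Lemma packet_form_ge0 w x : 0 <= packet_form w x.
Proof. exact: sqr_ge0. Qed.

Lemma packet_form_children w x :
  packet_form w x = \sum_(v <- ch w) packet_form v x.
Proof. exact: proj_children. Qed.

Lemma packet_form_root x : inner x (S x) = (packet_form root_node x)%:C.
Proof.
rewrite -inner_packet_content /packet_content/= proj_root//.
by rewrite -[sqrt_operator S (_ x)]/((_ \o _) x) (sqrt_operatorP Spos).2.
Qed.

Lemma packet_form_le w x : packet_form w x <= packet_form root_node x.
Proof.
rewrite /packet_form proj_root// ler_pXn2r ?nnegrE ?hnorm_ge0//.
exact: proj_le.
Qed.

Lemma packet_form_parallelogram w x y :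
  packet_form w (x + y) + packet_form w (x - y) =
  2 * (packet_form w x + packet_form w y).
Proof.
by rewrite /packet_form (linD Alin) (linB Alin) (linD (proj_lin hW w))
  (linB (proj_lin hW w)) parallelogram.
Qed.

Local Notation basis := (@hilbert_basis R H).

Lemma trace_packet_content w :
  (trace (packet_content W S w) = \esum_(e in basis) (packet_form w e)%:E)%E.
Proof. by apply: eq_esum => e _; rewrite inner_packet_content. Qed.

Lemma trace_packet_root : (trace S = \esum_(e in basis) (packet_form root_node e)%:E)%E.
Proof. by apply: eq_esum => e _; rewrite packet_form_root. Qed.

Hypothesis Str : trace_class S.

Definition packet_mass w : R := fine (trace (packet_content W S w)).

(** The masses are finite because [C_w] is dominated by [S], whose trace is
    that of [|S| = S]. *)
Lemma packet_massE w : trace (packet_content W S w) = (packet_mass w)%:E.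
Proof.
rewrite /packet_mass fineK// trace_packet_content ge0_fin_numE; last first.
  by apply: esum_ge0 => e _; rewrite lee_fin packet_form_ge0.
apply: le_lt_trans Str.2; rewrite abs_operator_positive// trace_packet_root.
by apply: le_esum => e _; rewrite lee_fin packet_form_le.
Qed.

Lemma packet_mass_ge0 w : 0 <= packet_mass w.
Proof.
rewrite -lee_fin -packet_massE trace_packet_content; apply: esum_ge0 => e _.
by rewrite lee_fin packet_form_ge0.
Qed.

Lemma packet_mass_children w : packet_mass w = \sum_(v <- ch w) packet_mass v.
Proof.
apply: EFin_inj; rewrite -sumEFin -packet_massE trace_packet_content.
rewrite (eq_bigr (fun v => \esum_(e in basis) (packet_form v e)%:E)%E); last first.
  by move=> v _; rewrite -packet_massE trace_packet_content.
rewrite -esum_sum; last by move=> *; rewrite lee_fin packet_form_ge0.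
by apply: eq_esum => e _; rewrite packet_form_children sumEFin.
Qed.

Lemma packet_mass_root : trace S = (packet_mass root_node)%:E.
Proof. by rewrite -packet_massE trace_packet_content trace_packet_root. Qed.

Lemma packet_form_le_mass w x : packet_form w x <= hnorm x ^+ 2 * packet_mass w.
Proof.
apply: (@hs_bound _ _ (packet_mass w) (Defs.proj (W w) \o sqrt_operator S)); last first.
  by rewrite -packet_massE trace_packet_content.
have [_ [M M0 AM]] := (bounded_operatorP _).1 Apos.1.
apply/bounded_operatorP; split.
  by move=> a y z /=; rewrite Alin (proj_lin hW).
by exists M => // y /=; apply: le_trans (AM y); exact: proj_le.
Qed.

End PacketContent.

(** * Measures on the boundary of the tree *)

Section Cylinders.
Context {T : rooted_tree}.
Implicit Types (u v w : T) (o : boundary T) (n m k : nat).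

Lemma ray_level o n : o n \in level T n.
Proof.
elim: n => [|n IH]; first by rewrite (rayP o).1 mem_head.
by apply/mem_levelS; exists (o n) => //; exact: (rayP o).2.
Qed.

Lemma cyl_level n w o : w \in level T n -> cyl w o <-> o n = w.
Proof.
move=> wn; split=> [[m om]|]; last by exists n.
by rewrite (level_unique wn (m := m)) ?om// -om ray_level.
Qed.

Lemma ray_prefix o o' n k : (k <= n)%N -> o n = o' n -> o k = o' k.
Proof.
move=> /subnK <-; elim: (n - k)%N => [//|j IH]; rewrite addSn => oo'.
apply: IH; apply: (ch_inj ((rayP o).2 _)).
by rewrite oo'; exact: (rayP o').2.
Qed.

Lemma cyl_root : cyl root_node = [set: boundary T].
Proof. by apply/seteqP; split=> // o _; exists 0%N; exact: (rayP o).1. Qed.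

Lemma cyl_nested u v o : cyl u o -> cyl v o -> cyl u `<=` cyl v \/ cyl v `<=` cyl u.
Proof.
wlog : u v / exists n m, [/\ (n <= m)%N, o n = u & o m = v].
  move=> IH [n un] [m vm]; have [nm|mn] := leqP n m.
    by apply: IH; [exists n, m|exists n|exists m].
  by rewrite orC; apply: IH; [exists m, n; rewrite ltnW|exists m|exists n].
move=> [n [m [nm un om]]] _ _; right => o'.
have vm : v \in level T m by rewrite -om ray_level.
move=> /(cyl_level _ vm) o'm; exists n.
by rewrite (@ray_prefix o' o m n)// o'm om.
Qed.

(** Disjoint cylinders meet in the empty set, which need not be a cylinder. *)
Definition cyl_system : set (set (boundary T)) := range (@cyl T) `|` [set set0].

Lemma cyl_system_setI : setI_closed cyl_system.
Proof.
move=> A B [[u _ <-]|->]; last by move=> _; right; rewrite set0I.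
move=> [[v _ <-]|->]; last by right; rewrite setI0.
have [->|/set0P[r [ur vr]]] := eqVneq (cyl u `&` cyl v) set0; first by right.
left; have [uv|vu] := cyl_nested ur vr.
  by exists u => //; rewrite setIidl.
by exists v => //; rewrite setIidr.
Qed.

Lemma cyl_measurable w : measurable (cyl w : set (borel_boundary T)).
Proof. by apply: sub_sigma_algebra; exists w. Qed.

Context {R : realType}.

(** The pi-system theorem, [cyl_system] being stable under intersection and
    containing the whole space as the cylinder of the root. *)
Lemma cyl_measure_unique (m1 m2 : {measure set (borel_boundary T) -> \bar R}) :
  (forall w, m1 (cyl w) = m2 (cyl w)) -> (m1 setT < +oo)%E ->
  forall A : set (borel_boundary T), measurable A -> m1 A = m2 A.
Proof.
move=> m12 m1fin A mA.
apply: (@measure_unique _ R (borel_boundary T) cyl_system (fun=> setT)) => //.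
- apply/seteqP; split; apply: smallest_sub; try exact: smallest_sigma_algebra.
    by move=> B rB; apply: sub_sigma_algebra; left.
  move=> B [rB|->]; last by have [] := smallest_sigma_algebra setT (range (@cyl T)).
  by apply: sub_sigma_algebra.
- exact: cyl_system_setI.
- by move=> _; left; exists root_node => //; exact: cyl_root.
- by rewrite bigcup_const.
- by move=> B [[w _ <-]|->]; [exact: m12|rewrite !measure0].
Qed.

End Cylinders.

Section FiniteMeasure.
Context d (X : measurableType d) (R : realType).

(** The proof is an argument so that the finite measure instance finds it. *)
Definition finite_measure_of (m : {measure set X -> \bar R}) of fin_num_fun m :
  set X -> \bar R := m.

Variables (m : {measure set X -> \bar R}) (mfin : fin_num_fun m).
HB.instance Definition _ := Measure.on (finite_measure_of mfin).
HB.instance Definition _ :=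
  Measure_isFinite.Build _ _ _ (finite_measure_of mfin) mfin.

End FiniteMeasure.

(** * Measures with prescribed masses of cylinders *)

Section TreeMeasure.
Context {R : realType} {T : rooted_tree}.
Variable m : T -> R.
Hypothesis m_ge0 : forall w, 0 <= m w.
Hypothesis m_children : forall w, m w = \sum_(v <- ch w) m v.
Implicit Types (u v w : T) (t : R) (n k : nat).

(** Cut [[0, sum of m)] into consecutive intervals of lengths [m v]: this gives
    the [v] whose interval contains [t], and the position of [t] in it. The
    root is a default value beyond the last interval. *)
Fixpoint locate (s : seq T) t : T * R :=
  if s is v :: s' then if t < m v then (v, t) else locate s' (t - m v)
  else (root_node, t).

Lemma locate_mem s t : 0 <= t < \sum_(v <- s) m v ->
  (locate s t).1 \in s /\ 0 <= (locate s t).2 < m (locate s t).1.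
Proof.
elim: s t => [|v s IH] t; first by rewrite big_nil; case: ltgtP.
rewrite big_cons => /andP[t0 tlt] /=; case: ltP => tv /=.
  by rewrite mem_head t0.
have [|h1 h2] := IH (t - m v); first by rewrite subr_ge0 tv ltrBlDl.
by rewrite inE h1 orbT.
Qed.

Lemma locate_interval s v : uniq s -> v \in s -> exists b : R,
  [/\ 0 <= b, b + m v <= \sum_(u <- s) m u &
      forall t, 0 <= t < \sum_(u <- s) m u ->
        ((locate s t).1 == v) = (b <= t < b + m v) /\
        ((locate s t).1 = v -> (locate s t).2 = t - b)].
Proof.
elim: s => //= u s IH /andP[us uniqs]; rewrite inE big_cons.
have s0 : 0 <= \sum_(j <- s) m j by apply: sumr_ge0 => j _; exact: m_ge0.
have [-> _|vu /= vs] := eqVneq v u.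
  exists 0; split; rewrite ?add0r ?lerDl// => t /andP[t0 tlt]; rewrite t0 subr0.
  case: ltP => tu /=; first by rewrite eqxx.
  have [|h _] := @locate_mem s (t - m u); first by rewrite subr_ge0 tu ltrBlDl.
  have nu : (locate s (t - m u)).1 != u by apply: contraNneq us => <-.
  by split; [exact: negbTE|move=> e; rewrite e eqxx in nu].
have [b [b0 bs hb]] := IH uniqs vs.
exists (m u + b); split; first by rewrite addr_ge0.
  by rewrite -addrA lerD2l.
move=> t /andP[t0 tlt]; case: ltP => tu /=.
  split; last by move=> uv; rewrite uv eqxx in vu.
  rewrite eq_sym (negbTE vu); apply/esym/negbTE; rewrite negb_and -ltNge.
  by rewrite (lt_le_trans tu) ?lerDl.
have [|h1 h2] := hb (t - m u); first by rewrite subr_ge0 tu ltrBlDl.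
split; first by rewrite h1 lerBrDl ltrBlDl addrA.
by move=> /h2 ->; rewrite opprD addrA.
Qed.

Fixpoint descend t n : T * R :=
  if n is k.+1 then locate (ch (descend t k).1) (descend t k).2
  else (root_node, t).

Local Notation M := (m root_node).

Lemma descend_pos t n : 0 <= t < M ->
  0 <= (descend t n).2 < m (descend t n).1.
Proof.
move=> tM; elim: n => [//|n IH] /=.
by rewrite m_children in IH; have [] := locate_mem IH.
Qed.

Lemma descend_ch t n : 0 <= t < M -> (descend t n.+1).1 \in ch (descend t n).1.
Proof.
move=> /(descend_pos n); rewrite m_children => h.
by have [] := locate_mem h.
Qed.

(** Intervals of children are consecutive pieces of the interval of the
    parent, so offsets add up along a branch. *)
Lemma descend_interval n w : w \in level T n -> exists a : R,
  [/\ 0 <= a, a + m w <= M & forall t, 0 <= t < M ->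
        ((descend t n).1 == w) = (a <= t < a + m w) /\
        ((descend t n).1 = w -> (descend t n).2 = t - a)].
Proof.
elim: n w => [w|n IH w /mem_levelS[u un wu]].
  rewrite inE => /eqP ->; exists 0; split; rewrite ?add0r// => t tM.
  by rewrite tM eqxx subr0.
have [a [a0 aM ha]] := IH u un.
have [b [b0 bu hb]] := locate_interval (ch_uniq u) wu.
rewrite -m_children in bu hb.
exists (a + b); split; first by rewrite addr_ge0.
  by rewrite -addrA; apply: le_trans aM; rewrite lerD2l.
move=> t tM; have [ha1 ha2] := ha t tM.
have [e|ne] := eqVneq (descend t n).1 u.
  have pos := descend_pos n tM; rewrite e in pos.
  have [hb1 hb2] := hb _ pos.
  rewrite /= e; split; last by move=> /hb2 ->; rewrite ha2// opprD addrA.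
  by rewrite hb1 ha2// lerBrDl ltrBlDl addrA.
have nw : (descend t n.+1).1 != w.
  apply: contraNneq ne => dw; have := descend_ch n tM; rewrite dw => wd.
  by rewrite (ch_inj wd wu).
split; last by move=> dw; rewrite dw eqxx in nw.
rewrite (negbTE nw); apply/esym/negbTE; apply: contra_neqN ne => /andP[h1 h2].
apply/eqP; rewrite ha1; apply/andP; split; lra.
Qed.

(** Constant outside [[0, m root_node)], for measurability on the whole line. *)
Definition interval_ray t : borel_boundary T :=
  if pselect (infinite_path (fun n => (descend t n).1) /\ 0 <= t < M) is left p
  then Ray p.1 else point.

Lemma interval_rayE t n : 0 <= t < M -> interval_ray t n = (descend t n).1.
Proof.
move=> tM; rewrite /interval_ray; case: pselect => // -[]; split=> //; split=> // k.
exact: descend_ch.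
Qed.

Let I : set R := `[0, M[%classic.

Lemma interval_ray_cyl w : exists a : R,
  [/\ 0 <= a, a + m w <= M &
      interval_ray @^-1` cyl w `&` I = `[a, a + m w[%classic].
Proof.
have [n wn] := level_exists w; have [a [a0 aM ha]] := descend_interval wn.
exists a; split=> //; apply/seteqP; split=> t /=; rewrite /I/= !in_itv/=.
  move=> [/(cyl_level _ wn) tw tM]; have [<- _] := ha t tM.
  by rewrite -interval_rayE// tw.
move=> taw; have tM : 0 <= t < M by case/andP: taw => h1 h2; apply/andP; split; lra.
split=> //; apply/(cyl_level _ wn); rewrite interval_rayE//.
by have [h _] := ha t tM; apply/eqP; rewrite h.
Qed.

Lemma interval_ray_measurable :
  measurable_fun [set: R] (interval_ray : R -> borel_boundary T).
Proof.
apply: (@measurability _ _ _ (borel_boundary T) setT interval_ray (range (@cyl T))) => // _ [_ [w _ <-] <-]; rewrite setTI.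
rewrite -(setIT (_ @^-1` _)) -(setUv I) setIUr; apply: measurableU.
  by have [a [_ _ ->]] := interval_ray_cyl w; exact: measurable_itv.
have out t : ~ I t -> interval_ray t = point.
  by rewrite /I/= in_itv/= /interval_ray; case: pselect => // -[? tM] /(_ tM).
have mI : measurable (~` I) by apply: measurableC; exact: measurable_itv.
have [wp|wp] := pselect (cyl w point).
  rewrite (_ : _ `&` _ = ~` I)//; apply/seteqP; split=> t //=; first by case.
  by move=> tI; split=> //; rewrite out.
rewrite (_ : _ `&` _ = set0)//; apply/seteqP; split=> t //= -[+ tI].
by rewrite out.
Qed.

(** Push Lebesgue measure on [[0, m root_node)] forward along [interval_ray]:
    the preimage of the cylinder of [w] is an interval of length [m w]. Unlike
    an extension of the premeasure on cylinders, this needs no compactness of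
    the boundary. *)
Lemma tree_measure_exists : exists mu : {finite_measure set (borel_boundary T) -> \bar R},
  forall w, mu (cyl w) = (m w)%:E.
Proof.
have mI : measurable I by exact: measurable_itv.
pose leb : {measure set _ -> \bar R} := mrestr (@lebesgue_measure R) mI.
pose push := (pushforward leb interval_ray : {measure set (borel_boundary T) -> \bar R}).
pose mu0 := push interval_ray_measurable.
have mu0E w : mu0 (cyl w) = (m w)%:E.
  rewrite /mu0 /push /= /pushforward /mrestr.
  have [a [_ _ ->]] := interval_ray_cyl w; rewrite lebesgue_measure_itv/= lte_fin.
  rewrite ltrDl; case: ltP => mw; first by rewrite -EFinB addrAC subrr add0r.
  by congr _%:E; apply/eqP; rewrite eq_le m_ge0.
have mu0_fin : fin_num_fun mu0.
  by apply: lty_fin_num_fun; rewrite -cyl_root mu0E ltry.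
by exists (finite_measure_of mu0_fin).
Qed.

End TreeMeasure.

(** * Densities *)

Section DensityMeasure.
Context d (X : measurableType d) (R : realType).
Variables (mu : {measure set X -> \bar R}) (f : X -> \bar R).
Hypotheses (mf : measurable_fun setT f) (f0 : forall x, (0 <= f x)%E).

(** The hypotheses are arguments so that the measure instance finds them. *)
Definition density_measure of measurable_fun setT f & (forall x, (0 <= f x)%E) :
  set X -> \bar R := fun A => (\int[mu]_(x in A) f x)%E.

Local Notation nu := (density_measure mf f0).

Let nu0 : nu set0 = 0%E. Proof. exact: integral_set0. Qed.

Let nu_ge0 A : (0 <= nu A)%E. Proof. exact: integral_ge0. Qed.

Let nu_sigma_additive : semi_sigma_additive nu.
Proof. exact: semi_sigma_additive_nng_induced. Qed.

HB.instance Definition _ := isMeasure.Build _ _ _ nu nu0 nu_ge0 nu_sigma_additive.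

End DensityMeasure.

Section CylinderIntegrals.
Context {R : realType} {T : rooted_tree}.
Local Notation X := (borel_boundary T).
Implicit Types (mu : {finite_measure set X -> \bar R}) (g h : X -> R).

Lemma Rintegral_EFin mu g w : mu.-integrable setT (EFin \o g) ->
  (\int[mu]_(o in cyl w) (g o)%:E)%E = (\int[mu]_(o in cyl w) g o)%:E.
Proof.
move=> ig; rewrite /Rintegral fineK//; apply: integrable_fin_num.
  exact: cyl_measurable.
by apply: integrableS ig => //; exact: cyl_measurable.
Qed.

Lemma ae_ge0_abse mu g : {ae mu, forall o, 0 <= g o} ->
  ae_eq mu setT (EFin \o g) (fun o => `|(g o)%:E|)%E.
Proof. by apply: filterS => o g0 _; rewrite gee0_abs. Qed.

(** The functions are replaced by their absolute values, whose densities with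
    respect to [mu] are finite measures; those are determined by the
    cylinders. *)
Lemma cyl_integral_ae_eq mu g h :
  mu.-integrable setT (EFin \o g) -> mu.-integrable setT (EFin \o h) ->
  {ae mu, forall o, 0 <= g o} -> {ae mu, forall o, 0 <= h o} ->
  (forall w : T, \int[mu]_(o in cyl w) g o = \int[mu]_(o in cyl w) h o) ->
  {ae mu, forall o, g o = h o}.
Proof.
move=> ig ih g0 h0 gh.
have mg := measurable_int _ ig; have mh := measurable_int _ ih.
pose G o := `|(g o)%:E|%E; pose K o := `|(h o)%:E|%E.
have mG : measurable_fun setT G by exact: measurableT_comp.
have mK : measurable_fun setT K by exact: measurableT_comp.
have gG A : measurable A -> (\int[mu]_(o in A) (g o)%:E = \int[mu]_(o in A) G o)%E.
  move=> mA; apply: ae_eq_integral => //; try exact: measurable_funTS.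
  by apply: filterS (ae_ge0_abse g0) => o /(_ I).
have hK A : measurable A -> (\int[mu]_(o in A) (h o)%:E = \int[mu]_(o in A) K o)%E.
  move=> mA; apply: ae_eq_integral => //; try exact: measurable_funTS.
  by apply: filterS (ae_ge0_abse h0) => o /(_ I).
have GK (A : set X) : measurable A ->
    (\int[mu]_(o in A) G o = \int[mu]_(o in A) K o)%E.
  have G0 o : (0 <= G o)%E by exact: abse_ge0.
  have K0 o : (0 <= K o)%E by exact: abse_ge0.
  apply: (cyl_measure_unique (m1 := density_measure mu mG G0)
                             (m2 := density_measure mu mK K0)).
    move=> w; rewrite /= /density_measure -gG -?hK; try exact: cyl_measurable.
    by rewrite !Rintegral_EFin// gh.
  by rewrite /= /density_measure; have /integrableP[] := ig.
have : ae_eq mu setT (EFin \o g) (EFin \o h).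
  apply: integral_ae_eq => // E _ mE.
  by rewrite -[LHS]/(\int[mu]_(o in E) (g o)%:E)%E gG// GK// -hK.
by apply: filterS => o /(_ I) /= -[].
Qed.

(** Domination on the cylinders extends to all Borel sets because the defect
    [c m - p] is itself the mass distribution of a measure. *)
Lemma cyl_dominates mu (m p : T -> R) (c : R) :
  (forall w, m w = \sum_(v <- ch w) m v) ->
  (forall w, p w = \sum_(v <- ch w) p v) ->
  (forall w, 0 <= p w) -> (forall w, p w <= c * m w) -> 0 <= c ->
  (forall w, mu (cyl w) = (m w)%:E) ->
  forall nu : {finite_measure set X -> \bar R},
    (forall w, nu (cyl w) = (p w)%:E) -> nu `<< mu.
Proof.
move=> madd padd p0 pm c0 muE nu nuE.
have [w|w|la laE] := @tree_measure_exists R T (fun w => c * m w - p w).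
- by rewrite subr_ge0.
- by rewrite madd padd mulr_sumr raddf_sum -big_split.
have addE A : measure_add nu la A = (nu A + la A)%E := measure_addE nu la A.
have sumE (A : set X) : measurable A -> (nu A + la A = c%:E * mu A)%E.
  move=> mA; rewrite -addE.
  apply: (cyl_measure_unique (m1 := measure_add nu la) (m2 := mscale (NngNum c0) mu)) => //.
    move=> w; rewrite -[LHS]/(measure_add nu la (cyl w)) addE nuE laE -[RHS]/(c%:E * mu (cyl w))%E muE -EFinD -EFinM.
    by congr _%:E; rewrite addrC subrK.
  by rewrite -[X in (X < _)%E]/(measure_add nu la setT) addE -cyl_root nuE laE -EFinD ltry.
apply/null_content_dominatesP => A mA muA.
apply/eqP; rewrite eq_le measure_ge0 andbT.
by rewrite -(mule0 c%:E) -muA -sumE// leeDl.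
Qed.

(** A Radon-Nikodym derivative [f] may be infinite on a null set; [fine \o f] is
    a real function with the same integrals. *)
Lemma density_exists mu (nu : {finite_measure set X -> \bar R}) : nu `<< mu ->
  exists e : X -> R, [/\ mu.-integrable setT (EFin \o e), forall o, 0 <= e o &
    forall A, measurable A -> nu A = (\int[mu]_(o in A) e o)%:E].
Proof.
move=> /radon_nikodym_finite[f [f0 fint nuE]].
have ef : ae_eq mu setT (EFin \o (fine \o f)) f.
  have := integrable_ae measurableT fint.
  by apply: filterS => o /(_ I) fo _ /=; rewrite fineK.
have mf := measurable_int _ fint.
have me : measurable_fun setT (EFin \o (fine \o f)).
  by apply/measurable_EFinP; exact: measurableT_comp.
have efA A : measurable A -> (\int[mu]_(o in A) (fine (f o))%:E = nu A)%E.
  move=> mA; rewrite nuE//; apply: ae_eq_integral => //; try exact: measurable_funTS.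
  by apply: filterS ef => o /(_ I).
exists (fine \o f); split.
- apply/integrableP; split=> //.
  under eq_integral do rewrite gee0_abs ?lee_fin ?fine_ge0//.
  by rewrite efA// -ge0_fin_numE// fin_num_measure.
- by move=> o; apply: fine_ge0.
- by move=> A mA; rewrite /Rintegral efA// fineK// fin_num_measure.
Qed.

End CylinderIntegrals.

Unset Implicit Arguments.

Theorem theorem3p1 (R : realType) (H : hilbertType R) (T : rooted_tree)
    (W : T -> set H) (hW : packet_decomposition W)
    (Rop : H -> H) (Rpos : positive_operator Rop) (Rtr : trace_class Rop) :
  exists mu : {finite_measure set (borel_boundary T) -> \bar R},
    [/\ (forall w : T, mu (cyl w) = trace (packet_content W Rop w)) /\
        (forall nu : {finite_measure set (borel_boundary T) -> \bar R},
          (forall w : T, nu (cyl w) = trace (packet_content W Rop w)) ->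
          forall A : set (borel_boundary T), measurable A -> nu A = mu A),
        mu [set: borel_boundary T] = trace Rop,
        forall x : H, exists e : borel_boundary T -> R,
          packet_density W Rop mu x e &
        forall e : H -> borel_boundary T -> R,
          (forall x : H, packet_density W Rop mu x (e x)) ->
          forall x y : H, {ae mu, forall o,
            e (x + y) o + e (x - y) o = 2 * (e x o + e y o)}].
Proof.
have [mu muE] := tree_measure_exists (packet_mass_ge0 hW Rpos Rtr)
  (packet_mass_children hW Rpos Rtr).
exists mu; split.
- split=> [w|nu nuE A]; first by rewrite muE (packet_massE hW).
  have numu w : nu (cyl w) = mu (cyl w) by rewrite nuE (packet_massE hW)// muE.
  have nufin : (nu setT < +oo)%E.
    by rewrite -cyl_root nuE (packet_massE hW)// ltry.
  exact: (cyl_measure_unique numu nufin).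
- by rewrite -cyl_root muE (packet_mass_root hW).
- move=> x.
  have [nu nuE] := tree_measure_exists (fun w => packet_form_ge0 W Rop w x)
    (fun w => packet_form_children Rop hW w x).
  have dom : nu `<< mu.
    apply: (cyl_dominates (packet_mass_children hW Rpos Rtr) _ _ _ _ muE nuE).
    + by move=> w; exact: packet_form_children.
    + by move=> w; exact: packet_form_ge0.
    + by move=> w; exact: packet_form_le_mass.
    + exact: sqr_ge0.
  have [e [ie e0 eE]] := density_exists dom.
  have eC w : \int[mu]_(o in cyl w) e o = packet_form W Rop w x.
    by apply: EFin_inj; rewrite -eE ?nuE//; exact: cyl_measurable.
  exists e; split=> //.
  + exact: aeW.
  + by move=> w; rewrite (inner_packet_content hW)// eC.
  + by rewrite (packet_form_root hW)// -eC cyl_root.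
- move=> e eP x y.
  have ie z : mu.-integrable setT (EFin \o e z) by case: (eP z).
  have e0 z : {ae mu, forall o, 0 <= e z o} by case: (eP z).
  have eC z w : \int[mu]_(o in cyl w) e z o = packet_form W Rop w z.
    by have [_ _ /(_ w) + _] := eP z; rewrite (inner_packet_content hW)// => -[].
  have mC w : measurable (cyl w : set (borel_boundary T)) := cyl_measurable w.
  have ieC z w : mu.-integrable (cyl w) (EFin \o e z).
    by apply: integrableS (ie z).
  apply: cyl_integral_ae_eq.
  + by have := integrableD measurableT (ie (x + y)) (ie (x - y)).
  + have := integrableZl measurableT 2 (integrableD measurableT (ie x) (ie y)).
    by apply: eq_integrable.
  + by apply: filterS2 (e0 (x + y)) (e0 (x - y)) => o; exact: addr_ge0.
  + by apply: filterS2 (e0 x) (e0 y) => o ex ey; rewrite mulr_ge0// addr_ge0.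
  + move=> w; rewrite (RintegralD (mC w) (ieC _ w) (ieC _ w)).
    rewrite (RintegralZl _ (mC w) (integrableD (mC w) (ieC x w) (ieC y w))).
    rewrite (RintegralD (mC w) (ieC x w) (ieC y w)) !eC.
    exact: packet_form_parallelogram.
Qed.
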